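(* Let $n\ge 3$ and let $g=\sum_{i=1}^n dx_i^2$ be the Euclidean metric on $\mathbb{R}^n$ with coordinates $x_1,\dots,x_n$. Let $R=T\odot g$, where $T=\sum_{i=1}^n f_i(x_i)\,dx_i^2$ and, for each $i$, $f_i$ is a smooth function depending only on the variable $x_i$, such that $3f_i(x_i)+f_j(x_j)\neq 0$ for all $x\in\mathbb{R}^n$ and all $i\neq j$. Then there is no metric $\bar g=\frac{1}{\varphi^2}g$ on $\mathbb{R}^n$ (with $\varphi$ a smooth nowhere vanishing function) whose Riemannian curvature tensor $\bar R$ satisfies $\bar R=R$.
   Context: For symmetric $(0,2)$-tensors $h,k$ the Kulkarni–Nomizu product is $(h\odot k)(X,Y,Z,W)=h(X,Z)k(Y,W)+h(Y,W)k(X,Z)-h(X,W)k(Y,Z)-h(Y,Z)k(X,W)$. The Riemannian curvature $(0,4)$-tensor is taken with the sign convention for which a metric $\tilde g$ of constant sectional curvature $c$ has curvature tensor $\frac{c}{2}\,\tilde g\odot\tilde g$; equivalently $R_{\tilde g}=W_{\tilde g}+A_{\tilde g}\odot\tilde g$ with $W_{\tilde g}$ the Weyl tensor and $A_{\tilde g}=\frac{1}{n-2}\left(\mathrm{Ric}_{\tilde g}-\frac{K_{\tilde g}}{2(n-1)}\tilde g\right)$ the Schouten tensor, $K_{\tilde g}$ being the scalar curvature. *)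

(* Defs.v *)
From HB Require Import structures.
From mathcomp Require Import all_boot all_order all_algebra.
From mathcomp Require Import all_classical all_reals all_analysis.
Import Order.TTheory GRing.Theory Num.Theory.
Import numFieldNormedType.Exports.

Set Implicit Arguments.
Unset Strict Implicit.
Unset Printing Implicit Defensive.

Local Open Scope classical_set_scope.
Local Open Scope ring_scope.

Section Tensors.
Variables (R : realType) (n : nat).

(* Points of R^n and tangent vectors at a point are both row vectors; tensor
   fields take the base point first, then their vector arguments. *)
Definition tensor2 := 'rV[R]_n -> 'rV[R]_n -> 'rV[R]_n -> R.
Definition tensor4 :=
  'rV[R]_n -> 'rV[R]_n -> 'rV[R]_n -> 'rV[R]_n -> 'rV[R]_n -> R.

Definition coord_vec (i : 'I_n) : 'rV[R]_n := delta_mx 0 i.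

Definition partial (i : 'I_n) (f : 'rV[R]_n -> R) : 'rV[R]_n -> R :=
  fun x => 'D_(coord_vec i) f x.

Definition iter_partial (s : seq 'I_n) (f : 'rV[R]_n -> R) : 'rV[R]_n -> R :=
  foldr partial f s.

Definition smooth (f : 'rV[R]_n -> R) : Prop :=
  forall s : seq 'I_n,
    continuous (iter_partial s f) /\
    (forall (i : 'I_n) (x : 'rV[R]_n),
       derivable (iter_partial s f) x (coord_vec i)).

Definition kulkarni_nomizu (h k : tensor2) : tensor4 := fun x X Y Z W =>
  h x X Z * k x Y W + h x Y W * k x X Z - h x X W * k x Y Z - h x Y Z * k x X W.

Definition euclidean_metric : tensor2 := fun _ X Y =>
  \sum_(i < n) X 0 i * Y 0 i.

Definition diag_tensor (f : 'I_n -> R -> R) : tensor2 := fun x X Y =>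
  \sum_(i < n) f i (x 0 i) * (X 0 i * Y 0 i).

Definition conformal_metric (phi : 'rV[R]_n -> R) (h : tensor2) : tensor2 :=
  fun x X Y => (phi x ^+ 2)^-1 * h x X Y.

Definition tensor2_mx (h : tensor2) (x : 'rV[R]_n) : 'M[R]_n :=
  \matrix_(i, j) h x (coord_vec i) (coord_vec j).

(* Gamma^k_{ij} of the Levi-Civita connection of h *)
Definition christoffel (h : tensor2) (k i j : 'I_n) (x : 'rV[R]_n) : R :=
  2^-1 * \sum_(l < n) invmx (tensor2_mx h x) k l *
    (partial i (fun y => tensor2_mx h y j l) x
     + partial j (fun y => tensor2_mx h y i l) x
     - partial l (fun y => tensor2_mx h y i j) x).

(* the d_l-component of R(d_i, d_j) d_k, where
   R(X, Y) = nabla_X nabla_Y - nabla_Y nabla_X - nabla_[X, Y] *)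
Definition curvature_coef (h : tensor2) (l k i j : 'I_n) (x : 'rV[R]_n) : R :=
  partial i (christoffel h l j k) x - partial j (christoffel h l i k) x
  + \sum_(m < n) (christoffel h m j k x * christoffel h l i m x
                  - christoffel h m i k x * christoffel h l j m x).

Definition curvature_op (h : tensor2) (x X Y Z : 'rV[R]_n) : 'rV[R]_n :=
  \row_l \sum_(i < n) \sum_(j < n) \sum_(k < n)
    X 0 i * Y 0 j * Z 0 k * curvature_coef h l k i j x.

(* The slots are ordered so that R(X, Y, X, Y) = h(R(X, Y) Y, X), i.e. constant
   sectional curvature c gives c/2 times the Kulkarni-Nomizu square of h. *)
Definition riemann (h : tensor2) : tensor4 := fun x X Y Z W =>
  h x (curvature_op h x X Y W) Z.

End Tensors.

Arguments euclidean_metric {R n}.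

Definition smooth1 (R : realType) (f : R -> R) : Prop :=
  forall (k : nat) (t : R), derivable (derive1n k f) t 1.

(* Main.v *)
Require Import Defs.
From mathcomp Require Import all_boot all_order all_algebra.
From mathcomp Require Import all_classical all_reals all_analysis.
From mathcomp Require Import ring lra.
Import Order.TTheory GRing.Theory Num.Theory.
Import numFieldNormedType.Exports.

(** The curvature of [phi^-2 g] is the Kulkarni-Nomizu product of
    [phi^-3 Hess phi - |grad phi|^2 / (2 phi^4) g] with [g]. As [n >= 3], that
    product determines its first factor, so the curvature equation says that
    [phi_ij = 0] for [i != j] and
    [2 phi phi_ii = 2 f_i phi^4 + |grad phi|^2].
    The first condition makes [phi_ii] independent of [x_j]; differentiating the
    second one along [x_j] and eliminating [phi_ii] and [phi_jj] gives
    [phi_j (3 f_i + f_j) = 0]. Hence [grad phi = 0], so every [f_i] vanishes,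
    contradicting [3 f_i + f_j <> 0]. *)

Set Implicit Arguments.
Unset Strict Implicit.
Unset Printing Implicit Defensive.

Local Open Scope classical_set_scope.
Local Open Scope ring_scope.

(** * Directional derivatives and invariance under translation along a line *)

Section DirectionalDerivative.
Variables (R : realType) (V : normedModType R).
Implicit Types (F : V -> R) (x v : V).

Lemma is_derive_inv F x v dF : F x != 0 -> is_derive x v F dF ->
  is_derive x v (fun y => (F y)^-1) (- (F x) ^- 2 * dF).
Proof.
move=> Fx0 dFx; constructor; first by apply: derivableV => //; case: dFx.
by rewrite deriveV //; case: dFx => _ ->.
Qed.

Lemma is_derive_line_invariant F x v :
  (forall t : R, F (t *: v + x) = F x) -> is_derive x v F 0.
Proof.
move=> Fx; have quot0 :
    (fun h : R => h^-1 *: ((F \o shift x) (h *: v) - F x)) = cst 0.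
  by apply/funext => h /=; rewrite Fx subrr scaler0.
by constructor; rewrite /derivable /derive quot0;
  [exact: is_cvg_cst | exact: lim_cst].
Qed.

(** The restriction of [F] to the line through [x] in direction [v] is a function of one real
    variable with zero derivative, hence constant. *)
Lemma line_invariant_of_derive0 F v :
  (forall x, is_derive x v F 0) -> forall (t : R) x, F (t *: v + x) = F x.
Proof.
move=> dF t x; pose G (s : R) := F (s *: v + x).
have -> : F x = G 0 by rewrite /G scale0r add0r.
apply: (@is_derive_0_is_cst _ G) => s.
have quotE : (fun h : R => h^-1 *: ((G \o shift s) (h *: (1 : R)) - G s)) =
    (fun h : R => h^-1 *: ((F \o shift (s *: v + x)) (h *: v) - F (s *: v + x))).
  by apply/funext => h; rewrite /G /= -[h *: 1]/(h * 1) mulr1 scalerDl addrA.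
have [cF DF] := dF (s *: v + x).
by constructor; rewrite /derivable /derive quotE.
Qed.

(** The difference quotients of [F] at [t *: v + x] and at [x] coincide, so no derivatives have to
    be commuted. *)
Lemma derive_line_invariant F v w (t : R) :
  (forall x, F (t *: v + x) = F x) ->
  forall x, derive F (t *: v + x) w = derive F x w.
Proof.
move=> Fv x; rewrite /derive.
suff -> : (fun h : R => h^-1 *:
    ((F \o shift (t *: v + x)) (h *: w) - F (t *: v + x))) =
    (fun h : R => h^-1 *: ((F \o shift x) (h *: w) - F x)) by [].
by apply/funext => h /=; rewrite addrCA !Fv.
Qed.

End DirectionalDerivative.

(** * Kronecker delta contractions and tensors evaluated on coordinate vectors *)

Section KroneckerSums.
Variables (R : realType) (n : nat).

Lemma sum_delta (F : 'I_n -> R) i : \sum_m (m == i)%:R * F m = F i.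
Proof.
rewrite (bigD1 i) //= eqxx mul1r big1 ?addr0 // => m /negbTE ->.
by rewrite mul0r.
Qed.

(** The two factors are the Christoffel symbols [Gamma^m_jk] and [Gamma^l_im] of [phi^-2 g] when [b]
    is the gradient of [log |phi|]; this is the quadratic part of its curvature. *)
Lemma sum_delta_quadratic (b : 'I_n -> R) (i j k l : 'I_n) :
  \sum_m ((j == k)%:R * b m - (m == k)%:R * b j - (m == j)%:R * b k)
       * ((i == m)%:R * b l - (l == m)%:R * b i - (l == i)%:R * b m) =
  (l == k)%:R * b i * b j + 2 * (l == i)%:R * b j * b k
  - (i == k)%:R * b l * b j + (l == j)%:R * b i * b k
  - (i == j)%:R * b k * b l
  - (j == k)%:R * (l == i)%:R * \sum_m b m ^+ 2.
Proof.
pose G m := (i == m)%:R * b l - (l == m)%:R * b i - (l == i)%:R * b m.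
(* Apart from the multiple of [b m ^+ 2], each summand carries one delta in [m], which collapses its
   sum. [G] stays folded in the last two, since it is only evaluated at [k] and [j]. *)
have split_term m :
    ((j == k)%:R * b m - (m == k)%:R * b j - (m == j)%:R * b k) * G m =
    (m == i)%:R * ((j == k)%:R * b l * b m)
    + (m == l)%:R * (- (j == k)%:R * b i * b m)
    + (- (j == k)%:R * (l == i)%:R) * b m ^+ 2
    + (m == k)%:R * (- b j * G m) + (m == j)%:R * (- b k * G m).
  have -> : (m == i)%:R * ((j == k)%:R * b l * b m)
    + (m == l)%:R * (- (j == k)%:R * b i * b m)
    + (- (j == k)%:R * (l == i)%:R) * b m ^+ 2 = (j == k)%:R * b m * G m.
    rewrite /G [i == m]eq_sym [l == m]eq_sym.
    move: (m == i)%:R (m == l)%:R (l == i)%:R (j == k)%:R => d1 d2 d3 d4.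
    move: (b m) (b l) (b i) => bm bl bi; ring.
  move: (G m) (m == k)%:R (m == j)%:R (j == k)%:R => g d1 d2 d3.
  move: (b m) (b j) (b k) => bm bj bk; ring.
rewrite (eq_bigr _ (fun m _ => split_term m)) !big_split /= -mulr_sumr.
rewrite (sum_delta (fun m => (j == k)%:R * b l * b m)).
rewrite (sum_delta (fun m => - (j == k)%:R * b i * b m)).
rewrite (sum_delta (fun m => - b j * G m)) (sum_delta (fun m => - b k * G m)).
rewrite /G; move: (\sum_m _) => S.
move: (l == i)%:R (i == j)%:R (i == k)%:R (j == k)%:R => d1 d2 d3 d4.
move: (l == j)%:R (l == k)%:R (b i) (b j) (b k) (b l) => d5 d6 bi bj bk bl; ring.
Qed.

Lemma sum_coord_vec (F : 'I_n -> R) i :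
  \sum_m (coord_vec R i) 0 m * F m = F i.
Proof.
by rewrite -[RHS]sum_delta; apply: eq_bigr => m _; rewrite mxE eqxx.
Qed.

Lemma euclidean_coord_vec x i j :
  @euclidean_metric R n x (coord_vec R i) (coord_vec R j) = (i == j)%:R.
Proof. by rewrite /euclidean_metric sum_coord_vec mxE eqxx. Qed.

Lemma diag_tensor_coord_vec (f : 'I_n -> R -> R) x i j :
  diag_tensor f x (coord_vec R i) (coord_vec R j) = (i == j)%:R * f i (x 0 i).
Proof.
rewrite /diag_tensor.
under eq_bigr => m _ do rewrite mulrCA.
by rewrite sum_coord_vec mxE eqxx mulrC.
Qed.

Lemma curvature_op_coord_vec (h : tensor2 R n) x i j k :
  curvature_op h x (coord_vec R i) (coord_vec R j) (coord_vec R k) =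
  \row_l curvature_coef h l k i j x.
Proof.
apply/rowP => l; rewrite !mxE.
rewrite -[RHS](sum_coord_vec (fun a => curvature_coef h l k a j x)).
apply: eq_bigr => a _.
rewrite -(sum_coord_vec (fun b => curvature_coef h l k a b x) j) mulr_sumr.
apply: eq_bigr => b _.
rewrite -(sum_coord_vec (fun c => curvature_coef h l c a b x) k) !mulr_sumr.
by apply: eq_bigr => c _; rewrite !mulrA.
Qed.

End KroneckerSums.

(** * Christoffel symbols and curvature of [phi^-2 g] *)

Section ConformallyFlat.
Variables (R : realType) (n : nat) (phi : 'rV[R]_n -> R).
Hypothesis phi_neq0 : forall x, phi x != 0.
Hypothesis phi_derivable : forall i x, derivable phi x (coord_vec R i).
Hypothesis partial_phi_derivable :
  forall i j x, derivable (partial j phi) x (coord_vec R i).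

Let gbar := conformal_metric phi (@euclidean_metric R n).

(** The gradient of [log |phi|], in which the Christoffel symbols are linear. *)
Definition log_partial i x := partial i phi x / phi x.
Local Notation a := log_partial.

Lemma tensor2_mx_conformal x : tensor2_mx gbar x = (phi x ^- 2)%:M.
Proof.
apply/matrixP => i j; rewrite !mxE /gbar /conformal_metric euclidean_coord_vec.
by rewrite mulr_natr.
Qed.

Lemma is_derive_inv_sqr i x :
  is_derive x (coord_vec R i) (fun y => phi y ^- 2)
    (- 2 * (phi x ^- 2) * a i x).
Proof.
have dphi : is_derive x (coord_vec R i) phi (partial i phi x).
  exact/derivableP/phi_derivable.
have dphi2 := is_deriveX 2 dphi.
have phi2_neq0 : (phi ^+ 2) x != 0 by rewrite fctE expf_neq0.
apply: is_derive_eq (is_derive_inv phi2_neq0 dphi2) _.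
by rewrite /log_partial fctE /= expr1 /GRing.scale /=; field; exact: phi_neq0.
Qed.

Lemma partial_conformal i j k x :
  partial k (fun y => tensor2_mx gbar y i j) x =
  (i == j)%:R * (- 2 * (phi x ^- 2) * a k x).
Proof.
have -> : (fun y => tensor2_mx gbar y i j) =
    (i == j)%:R \*: (fun y => phi y ^- 2).
  by apply/funext => y; rewrite tensor2_mx_conformal mxE /= scaler_nat.
by rewrite /partial; have [_ ->] := is_deriveZ (i == j)%:R (is_derive_inv_sqr k x).
Qed.

(** The inverse metric is [phi^2] times the identity: only [l = k] survives in the sum, and [phi^2]
    cancels the [phi^-2] of the differentiated metric. *)
Lemma christoffel_conformal k i j x : christoffel gbar k i j x =
  (i == j)%:R * a k x - (k == j)%:R * a i x - (k == i)%:R * a j x.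
Proof.
rewrite /christoffel tensor2_mx_conformal invmx_scalar.
under eq_bigr => l _.
  rewrite !partial_conformal mxE invrK [k == l]eq_sym.
  rewrite -[_ *+ (l == k)]mulr_natl -mulrA.
  over.
rewrite sum_delta [j == k]eq_sym [i == k]eq_sym.
have := phi_neq0 x.
move: (phi x) (a i x) (a j x) (a k x) => p ai aj ak p0.
move: (k == j)%:R (k == i)%:R (i == j)%:R => d1 d2 d3.
by field.
Qed.

Lemma is_derive_log_partial i m x : is_derive x (coord_vec R m) (a i)
  (partial m (partial i phi) x / phi x - a i x * a m x).
Proof.
have d1 : is_derive x (coord_vec R m) phi (partial m phi x).
  exact/derivableP/phi_derivable.
have d2 : is_derive x (coord_vec R m) (partial i phi) (partial m (partial i phi) x).
  exact/derivableP/partial_phi_derivable.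
have d3 := is_deriveM d2 (is_derive_inv (phi_neq0 x) d1).
apply: is_derive_eq d3 _.
rewrite /log_partial /GRing.scale /=; have := phi_neq0 x.
move: (phi x) (partial m _ x) (partial m _ x) (partial i _ x) => *.
by field.
Qed.

Lemma partial_christoffel_conformal m k i j x :
  partial m (christoffel gbar k i j) x =
  (i == j)%:R * (partial m (partial k phi) x / phi x - a k x * a m x)
  - (k == j)%:R * (partial m (partial i phi) x / phi x - a i x * a m x)
  - (k == i)%:R * (partial m (partial j phi) x / phi x - a j x * a m x).
Proof.
have -> : christoffel gbar k i j =
    (i == j)%:R \*: a k - (k == j)%:R \*: a i - (k == i)%:R \*: a j.
  by apply/funext => y; rewrite christoffel_conformal.
have d l := is_derive_log_partial l m x.
by rewrite /partial; have [_ ->] := is_deriveB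
  (is_deriveB (is_deriveZ (i == j)%:R (d k)) (is_deriveZ (k == j)%:R (d i)))
  (is_deriveZ (k == i)%:R (d j)).
Qed.

Lemma sum_christoffel_conformal l k i j x :
  \sum_(m < n) christoffel gbar m j k x * christoffel gbar l i m x =
  (l == k)%:R * a i x * a j x + 2 * (l == i)%:R * a j x * a k x
  - (i == k)%:R * a l x * a j x + (l == j)%:R * a i x * a k x
  - (i == j)%:R * a k x * a l x
  - (j == k)%:R * (l == i)%:R * \sum_(m < n) a m x ^+ 2.
Proof.
rewrite -(sum_delta_quadratic (a ^~ x)); apply: eq_bigr => m _.
by rewrite !christoffel_conformal.
Qed.

(* [phi x ^- 2] times the Schouten tensor of [gbar], so that the curvature of
   [gbar] is its Kulkarni-Nomizu product with the Euclidean metric. *)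
Definition scaled_schouten x i j : R :=
  partial i (partial j phi) x / phi x ^+ 3
  - (i == j)%:R * (\sum_(m < n) partial m phi x ^+ 2) / (2 * phi x ^+ 4).

(* The hypothesis [k != l] spares us the symmetry of second derivatives. *)
Lemma riemann_conformal x i j k l : k != l ->
  riemann gbar x (coord_vec R i) (coord_vec R j) (coord_vec R k) (coord_vec R l)
  = scaled_schouten x i k * (j == l)%:R + scaled_schouten x j l * (i == k)%:R
    - scaled_schouten x i l * (j == k)%:R - scaled_schouten x j k * (i == l)%:R.
Proof.
move=> kl; rewrite /riemann curvature_op_coord_vec /gbar /conformal_metric.
rewrite /euclidean_metric; under eq_bigr do rewrite mulrC.
rewrite sum_coord_vec mxE /curvature_coef sumrB.
rewrite !partial_christoffel_conformal !sum_christoffel_conformal.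
rewrite (negbTE kl) mulr0n [k == i]eq_sym [k == j]eq_sym.
rewrite [j == i]eq_sym /scaled_schouten.
(* Both sides must contain the same sum [|grad phi|^2] before it is generalized for [field]. *)
rewrite (_ : \sum_(m < n) a m x ^+ 2 =
    (\sum_(m < n) partial m phi x ^+ 2) / phi x ^+ 2); last first.
  by rewrite mulr_suml; apply: eq_bigr => m _; rewrite /log_partial expr_div_n.
rewrite /log_partial; have := phi_neq0 x.
move: (phi x) (\sum_(m < n) _) => p S p0.
move: (i == j)%:R (i == k)%:R (i == l)%:R (j == k)%:R (j == l)%:R.
move: (partial i phi x) (partial j phi x) (partial k phi x) (partial l phi x).
move: (partial i (partial j phi) x) (partial j (partial i phi) x).
move: (partial i (partial k phi) x) (partial i (partial l phi) x).
move: (partial j (partial k phi) x) (partial j (partial l phi) x) => *.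
by field.
Qed.

End ConformallyFlat.

(** The pair has at most two elements. Taking [i = j] yields an index different from a single given
    one. *)
Lemma exists_third_ord (n : nat) (i j : 'I_n) : (3 <= n)%N ->
  exists2 k : 'I_n, k != i & k != j.
Proof.
move=> n3; have : (0 < #|predC (pred2 i j)|)%N.
  rewrite -(ltn_add2l #|pred2 i j|) cardC card_ord addn0.
  by rewrite (leq_ltn_trans _ n3) // card2; case: (_ != _).
by case/card_gt0P => k; rewrite !inE negb_or => /andP[ki kj]; exists k.
Qed.

(** * Consequences of the curvature equation for the derivatives of [phi] *)

Section PrescribedCurvature.
Variables (R : realType) (n : nat) (phi : 'rV[R]_n -> R) (f : 'I_n -> R -> R).
Hypothesis n_ge3 : (3 <= n)%N.
Hypothesis phi_smooth : smooth phi.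
Hypothesis phi_neq0 : forall x, phi x != 0.
Hypothesis riemannE : riemann (conformal_metric phi euclidean_metric) =
  kulkarni_nomizu (diag_tensor f) euclidean_metric.

Lemma is_derive_phi i x : is_derive x (coord_vec R i) phi (partial i phi x).
Proof. exact/derivableP/(phi_smooth [::]).2. Qed.

Lemma is_derive_partial_phi i j x :
  is_derive x (coord_vec R i) (partial j phi) (partial i (partial j phi) x).
Proof. exact/derivableP/(phi_smooth [:: j]).2. Qed.

Lemma scaled_schouten_eq x i j k l : k != l ->
  scaled_schouten phi x i k * (j == l)%:R
  + scaled_schouten phi x j l * (i == k)%:R
  - scaled_schouten phi x i l * (j == k)%:R
  - scaled_schouten phi x j k * (i == l)%:R
  = (i == k)%:R * f i (x 0 i) * (j == l)%:R
  + (j == l)%:R * f j (x 0 j) * (i == k)%:R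
  - (i == l)%:R * f i (x 0 i) * (j == k)%:R
  - (j == k)%:R * f j (x 0 j) * (i == l)%:R.
Proof.
move=> kl.
rewrite -(riemann_conformal phi_neq0 _ _ x i j kl).
- by rewrite riemannE /kulkarni_nomizu !diag_tensor_coord_vec
    !euclidean_coord_vec.
- by move=> m y; case: (is_derive_phi m y).
- by move=> m m' y; case: (is_derive_partial_phi m m' y).
Qed.

(** With a third index [k], the slots [(i, k, j, k)] isolate the entry [ij], and [T] is diagonal. *)
Lemma scaled_schouten_offdiag x i j : i != j -> scaled_schouten phi x i j = 0.
Proof.
move=> ij; have [k ki kj] := exists_third_ord i j n_ge3.
have jk : j != k by rewrite eq_sym.
have := scaled_schouten_eq x i k jk.
rewrite eqxx (negbTE ij) (negbTE kj) [i == k]eq_sym (negbTE ki).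
by rewrite !(mulr0, mul0r, mulr1, addr0, subr0).
Qed.

Lemma scaled_schouten_sum x i j : i != j ->
  scaled_schouten phi x i i + scaled_schouten phi x j j = f i (x 0 i) + f j (x 0 j).
Proof.
move=> ij; have := scaled_schouten_eq x i j ij.
rewrite !eqxx (negbTE ij) [j == i]eq_sym (negbTE ij).
by rewrite !(mulr0, mul0r, mulr1, mul1r, addr0, subr0).
Qed.

(** For three distinct indices, the three pairwise sums determine each summand. *)
Lemma scaled_schouten_diag x i : scaled_schouten phi x i i = f i (x 0 i).
Proof.
have [j ji _] := exists_third_ord i i n_ge3.
have [k ki kj] := exists_third_ord i j n_ge3.
have := scaled_schouten_sum x ji; have := scaled_schouten_sum x ki.
have := scaled_schouten_sum x kj.
by lra.
Qed.

Lemma hessian_offdiag x i j : i != j -> partial i (partial j phi) x = 0.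
Proof.
move=> ij; have := scaled_schouten_offdiag x ij.
rewrite /scaled_schouten (negbTE ij) !mul0r subr0 => /eqP.
by rewrite mulf_eq0 invr_eq0 expf_eq0 (negbTE (phi_neq0 x)) /= orbF => /eqP.
Qed.

Lemma hessian_diag x i : 2 * (phi x * partial i (partial i phi) x) =
  2 * f i (x 0 i) * phi x ^+ 4 + \sum_(m < n) partial m phi x ^+ 2.
Proof.
rewrite -scaled_schouten_diag /scaled_schouten eqxx mul1r.
have := phi_neq0 x; move: (phi x) (partial i _ x) (\sum_m _) => p h S p0.
by field.
Qed.

(** Since [phi_ji = 0], the function [partial i phi] itself is invariant along [x_j], and its
    derivative inherits this; no third derivative appears. *)
Lemma hessian_diag_invariant i j : i != j -> forall (t : R) x,
  partial i (partial i phi) (t *: coord_vec R j + x) =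
  partial i (partial i phi) x.
Proof.
move=> ij t; apply: derive_line_invariant => x.
apply: line_invariant_of_derive0 => y.
by rewrite -(@hessian_offdiag y j i) 1?eq_sym //; exact: is_derive_partial_phi.
Qed.

(** The off-diagonal Hessian vanishes, so only the summand [m = j] contributes. *)
Lemma is_derive_sqr_grad j x :
  is_derive x (coord_vec R j) (fun y => \sum_(m < n) partial m phi y ^+ 2)
    (2 * (partial j phi x * partial j (partial j phi) x)).
Proof.
have d := is_derive_sum (fun m => is_deriveX 2 (is_derive_partial_phi j m x)).
have -> : (fun y => \sum_(m < n) partial m phi y ^+ 2) =
    \sum_(m < n) partial m phi ^+ 2.
  by apply/funext => y; rewrite fct_sumE.
apply: is_derive_eq d _; rewrite (bigD1 j) //= big1 => [|m mj].
  by rewrite addr0 expr1 mulrA.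
by rewrite hessian_offdiag 1?eq_sym // scaler0.
Qed.

Lemma grad_factor i j x : i != j ->
  partial j phi x * (3 * f i (x 0 i) + f j (x 0 j)) = 0.
Proof.
move=> ij.
(* Differentiate [hessian_diag] at [i] along the [j]-th coordinate. *)
have dl : is_derive x (coord_vec R j)
    (fun y => 2 * (phi y * partial i (partial i phi) y))
    (2 * (partial j phi x * partial i (partial i phi) x)).
  have d0 := is_derive_line_invariant (hessian_diag_invariant ij ^~ x).
  have d := is_deriveZ 2 (is_deriveM (is_derive_phi j x) d0).
  by apply: is_derive_eq d _; rewrite scaler0 add0r [_ *: partial _ _ _]mulrC.
have dr : is_derive x (coord_vec R j)
    (fun y => 2 * f i (y 0 i) * phi y ^+ 4 + \sum_(m < n) partial m phi y ^+ 2)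
    (8 * f i (x 0 i) * phi x ^+ 3 * partial j phi x
     + 2 * (partial j phi x * partial j (partial j phi) x)).
  (* Moving along the [j]-th coordinate leaves [y 0 i] fixed, as [i != j]. *)
  have d0 : is_derive x (coord_vec R j) (fun y => f i (y 0 i)) 0.
    apply: is_derive_line_invariant => t.
    by rewrite !mxE (negbTE ij) andbF mulr0 add0r.
  have d := is_deriveM (is_deriveZ 2 d0) (is_deriveX 4 (is_derive_phi j x)).
  apply: is_derive_eq (is_deriveD d (is_derive_sqr_grad j x)) _.
  rewrite !scaler0 addr0 /= -[2 *: f _ _]/(2 * f i (x 0 i)).
  by congr (_ + _); rewrite /GRing.scale /=; ring.
have eq_lr : (fun y => 2 * (phi y * partial i (partial i phi) y)) =
    (fun y => 2 * f i (y 0 i) * phi y ^+ 4 + \sum_(m < n) partial m phi y ^+ 2).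
  by apply/funext => y; exact: hessian_diag.
have [_ Dl] := dl; have [_ Dr] := dr.
move: Dl; rewrite eq_lr Dr => E.
have := hessian_diag x i; have := hessian_diag x j; move: E.
have := phi_neq0 x.
move: (partial i (partial i phi) x) (partial j (partial j phi) x).
move: (phi x) (partial j phi x) (\sum_m _) (f i _) (f j _).
move=> p pj S fi fj hi hj p0 E Ej Ei.
have p4 : p ^+ 4 != 0 by rewrite expf_neq0.
apply: (mulfI p4); rewrite mulr0.
(* Half of [p] times the differentiated equation [E]; multiples [-pj] and [pj] of [hessian_diag] at
   [j] and [i] cancel [hj] and [hi], and the two copies of [S] cancel each other. *)
have -> : p ^+ 4 * (pj * (3 * fi + fj)) =
  2^-1 * (p * (8 * fi * p ^+ 3 * pj + 2 * (pj * hj)) - p * (2 * (pj * hi))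
    - pj * (2 * (p * hj) - (2 * fj * p ^+ 4 + S))
    + pj * (2 * (p * hi) - (2 * fi * p ^+ 4 + S))) by field.
by rewrite E Ej Ei !subrr !mulr0 !(subr0, addr0) mulr0.
Qed.

End PrescribedCurvature.

Theorem theorem3p5 (R : realType) (n : nat) (hn : (3 <= n)%N)
    (f : 'I_n -> R -> R) (hf : forall i : 'I_n, smooth1 (f i))
    (hne : forall (x : 'rV[R]_n) (i j : 'I_n), i != j ->
             3 * f i (x 0 i) + f j (x 0 j) <> 0) :
  ~ exists phi : 'rV[R]_n -> R,
      [/\ smooth phi,
          (forall x : 'rV[R]_n, phi x <> 0) &
          riemann (conformal_metric phi euclidean_metric)
          = kulkarni_nomizu (diag_tensor f) euclidean_metric].
Proof.
case=> phi [phi_smooth phi_nz riemannE].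
have phi_neq0 x : phi x != 0 by apply/eqP.
have grad0 j x : partial j phi x = 0.
  have [i ij _] := exists_third_ord j j hn.
  have /eqP := grad_factor hn phi_smooth phi_neq0 riemannE x ij.
  by rewrite mulf_eq0 => /orP[/eqP //|/eqP /(hne x _ _ ij)].
(* A zero gradient makes both terms of the scaled Schouten tensor vanish, and its diagonal entries
   are the [f i]. *)
have f0 i (x : 'rV[R]_n) : f i (x 0 i) = 0.
  rewrite -(scaled_schouten_diag hn phi_smooth phi_neq0 riemannE) /scaled_schouten.
  have -> : partial i phi = cst 0 by apply/funext => y; exact: grad0.
  rewrite /partial derive_cst mul0r big1 ?mulr0 ?mul0r ?subrr // => m _.
  by rewrite -/(partial m phi x) grad0 expr0n.
(* As [hn] is [2 < n], [Ordinal hn] is the index 2; any [j] distinct from it gives the contradiction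
   at the origin. *)
have [j ji _] := exists_third_ord (Ordinal hn) (Ordinal hn) hn.
by apply: (hne 0 _ _ ji); rewrite !f0 mulr0 addr0.
Qed.
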